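(* Let $H$ be a finite weakly nilpotent hypergroup. Then every closed subset of $H$ is strongly subnormal in $H$.
   Context: A hypergroup is a set $H$ with a hypermultiplication, i.e. a map $H\times H\to \mathcal P(H)$, $(p,q)\mapsto pq$ (the power set of $H$), where for subsets $P,Q\subseteq H$ one puts $PQ:=\bigcup_{p\in P,q\in Q}pq$, and $pQ:=\{p\}Q$, $Qp:=Q\{p\}$, such that: (i) $p(qr)=(pq)r$ for all $p,q,r\in H$; (ii) there is an element $1\in H$ with $s1=\{s\}$ for all $s\in H$; (iii) for each $s\in H$ there is an element $s^*\in H$ such that for all $p,q,r\in H$ with $r\in pq$ one has $q\in p^*r$ and $p\in rq^*$. A singleton $\{s\}$ is sometimes written $s$. For $S\subseteq H$, $S^*:=\{s^*: s\in S\}$. A nonempty subset $F\subseteq H$ is closed if $F^*F\subseteq F$; a closed subset is itself a hypergroup under the restricted hypermultiplication. A closed subset $F$ of $H$ is normal in $H$ if $Fh\subseteq hF$ for all $h\in H$, and strongly normal in $H$ if $h^*Fh\subseteq F$ for all $h\in H$. A closed subset $F$ of $H$ is strongly subnormal in $H$ if there is a chain of closed subsets $F=F_0\subseteq F_1\subseteq\cdots\subseteq F_n=H$ with $n>0$ such that $F_{i-1}$ is strongly normal in $F_i$ for all $1\le i\le n$. Quotient: for a closed subset $F$ of $H$ and $h\in H$ put $h^F:=FhF$, and for $F\subseteq S\subseteq H$ put $S//F:=\{h^F: h\in S\}$. With $a^F\cdot b^F:=\{x^F: x\in aFb\}$ the set $H//F$ is a hypergroup, with identity $1^F=F$ and $(h^F)^*=(h^*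 )^F$. Centre: $Z(H):=\{h\in H: hx=xh \text{ for all } x\in H,\ h^*h=\{1\}\}$. Upper center series: $Z_0(H)=\{1\}$, and for $i\ge1$, $Z_i(H)$ is determined by $Z_i(H)//Z_{i-1}(H)=Z(H//Z_{i-1}(H))$, i.e. $Z_i(H)=\{h\in H: h^{Z_{i-1}(H)}\in Z(H//Z_{i-1}(H))\}$; each $Z_i(H)$ is a normal closed subset of $H$. A hypergroup $H$ is weakly nilpotent if $Z_n(H)=H$ for some non-negative integer $n$. *)

(* Defs.v *)
From HB Require Import structures.
From mathcomp Require Import all_boot.

Set Implicit Arguments.
Unset Strict Implicit.
Unset Printing Implicit Defensive.

Definition complex_product (T : finType) (mul : T -> T -> {set T})
  (P Q : {set T}) : {set T} := \bigcup_(p in P) \bigcup_(q in Q) mul p q.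

(* hone and hstar are recorded as data: the axioms determine both of them
   uniquely from hmul. *)
HB.mixin Record isFinHypergroup T of Finite T := {
  hmul : T -> T -> {set T};
  hone : T;
  hstar : T -> T;
  hmulA : forall p q r : T,
    complex_product hmul [set p] (hmul q r) =
    complex_product hmul (hmul p q) [set r];
  hmulx1 : forall s : T, hmul s hone = [set s];
  hmul_star : forall p q r : T, r \in hmul p q ->
    q \in hmul (hstar p) r /\ p \in hmul r (hstar q)
}.

#[short(type="finHypergroupType")]
HB.structure Definition FinHypergroup := {T of isFinHypergroup T & Finite T}.

Arguments hone {s}.
Arguments hmul_star {_} [_ _ _] _.

Declare Scope hypergroup_scope.
Delimit Scope hypergroup_scope with hyp.
Notation "P :*: Q" := (complex_product hmul P Q)
  (at level 40, left associativity) : hypergroup_scope.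
Local Open Scope hypergroup_scope.

Section ClosedSubsets.
Variable H : finHypergroupType.
Implicit Types (F K P Q S : {set H}) (h : H).

Definition star_set S : {set H} := [set hstar s | s in S].

Definition hyperclosed F : bool := (F != set0) && (star_set F :*: F \subset F).

(* The hypergroup "in which" F is strongly normal is a closed subset K of H
   with the restricted hypermultiplication; K = [set: H] gives H itself. *)
Definition strongly_normal F K : Prop :=
  [/\ hyperclosed F, F \subset K &
      forall h, h \in K -> [set hstar h] :*: F :*: [set h] \subset F].

Definition strongly_subnormal F : Prop :=
  exists (n : nat) (C : nat -> {set H}),
    [/\ 0 < n, C 0 = F, C n = [set: H],
        forall i, i <= n -> hyperclosed (C i) &
        forall i, 0 < i <= n ->
          strongly_normal (C i.-1) (C i)].

Definition center : {set H} :=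
  [set h | [forall x, hmul h x == hmul x h] &
           hmul (hstar h) h == [set hone]].

Structure closed_subset := ClosedSubset {
  closed_subset_set :> {set H};
  closed_subsetP : hyperclosed closed_subset_set
}.

End ClosedSubsets.

Section BasicTheory.
Variable H : finHypergroupType.
Implicit Types (P Q R : {set H}) (p q r s x : H).

Lemma cprodP P Q x :
  reflect (exists p q, [/\ p \in P, q \in Q & x \in hmul p q]) (x \in P :*: Q).
Proof.
apply: (iffP bigcupP) => [[p pP /bigcupP[q qQ xpq]]|[p [q [pP qQ xpq]]]].
  by exists p, q.
by exists p => //; apply/bigcupP; exists q.
Qed.

Lemma mem_cprod P Q p q x :
  p \in P -> q \in Q -> x \in hmul p q -> x \in P :*: Q.
Proof. by move=> pP qQ xpq; apply/cprodP; exists p, q. Qed.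

Lemma cprod11 p q : [set p] :*: [set q] = hmul p q.
Proof. by rewrite /complex_product !big_set1. Qed.

Lemma cprodS P P' Q Q' :
  P \subset P' -> Q \subset Q' -> P :*: Q \subset P' :*: Q'.
Proof.
move=> /subsetP sP /subsetP sQ; apply/subsetP => x /cprodP[p [q [pP qQ xpq]]].
exact: mem_cprod (sP _ pP) (sQ _ qQ) xpq.
Qed.

Lemma cprodA P Q R : P :*: (Q :*: R) = P :*: Q :*: R.
Proof.
apply/setP => x; apply/cprodP/cprodP.
- case=> p [y [pP /cprodP[q [r [qQ rR yqr]]] xpy]].
  have: x \in [set p] :*: hmul q r by apply: mem_cprod yqr xpy; rewrite set11.
  rewrite hmulA => /cprodP[z [r' [zpq /set1P-> xzr]]].
  by exists z, r; split=> //; apply: mem_cprod zpq.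
- case=> y [r [/cprodP[p [q [pP qQ ypq]]] rR xyr]].
  have: x \in hmul p q :*: [set r] by apply: mem_cprod ypq _ xyr; rewrite set11.
  rewrite -hmulA => /cprodP[p' [z [/set1P-> zqr xpz]]].
  by exists p, z; split=> //; apply: mem_cprod zqr.
Qed.

Lemma hstarV1 s : hone \in hmul (hstar s) s.
Proof. by have [] := @hmul_star H s hone s; rewrite ?hmulx1 ?set11. Qed.

Lemma hstarK : involutive (@hstar H).
Proof.
move=> s; have [] := hmul_star (hstarV1 s).
by rewrite hmulx1 => /set1P.
Qed.

Lemma hstar1V s : hone \in hmul s (hstar s).
Proof. by have := hstarV1 (hstar s); rewrite hstarK. Qed.

Lemma hstar1 : hstar hone = hone :> H.
Proof. by have := hstarV1 (hone : H); rewrite hmulx1 => /set1P. Qed.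

Lemma hmul1x s : hmul hone s = [set s].
Proof.
apply/setP => x; rewrite in_set1; apply/idP/eqP => [x1s|->].
  have [_ /hmul_star[+ _]] := hmul_star x1s.
  by rewrite hmulx1 => /set1P/(can_inj hstarK).
by have [_] := hmul_star (hstar1V s); rewrite hstarK.
Qed.

Lemma mem_hmul_star p q r :
  (hstar r \in hmul (hstar q) (hstar p)) = (r \in hmul p q).
Proof.
have imp a b c : c \in hmul a b -> hstar c \in hmul (hstar b) (hstar a).
  by move=> /hmul_star[/hmul_star[_ /hmul_star[]]].
by apply/idP/idP => /imp //; rewrite !hstarK.
Qed.

Lemma hmulA_mem p q r x y :
  y \in hmul q r -> x \in hmul p y -> exists2 z, z \in hmul p q & x \in hmul z r.
Proof.
move=> yqr xpy; have : x \in [set p] :*: ([set q] :*: [set r]).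
  by rewrite cprod11; apply: mem_cprod yqr xpy; rewrite set11.
by rewrite cprodA cprod11 => /cprodP[z [r' [zpq /set1P-> xzr]]]; exists z.
Qed.

Lemma hmulA_mem' p q r x y :
  y \in hmul p q -> x \in hmul y r -> exists2 z, z \in hmul q r & x \in hmul p z.
Proof.
move=> ypq xyr; have : x \in [set p] :*: [set q] :*: [set r].
  by rewrite cprod11; apply: mem_cprod ypq _ xyr; rewrite set11.
by rewrite -cprodA cprod11 => /cprodP[p' [z [/set1P-> zqr xpz]]]; exists z.
Qed.

Lemma closedP (F : {set H}) :
  reflect [/\ hone \in F, forall x, x \in F -> hstar x \in F &
              forall x y z, x \in F -> y \in F -> z \in hmul x y -> z \in F]
          (hyperclosed F).
Proof.
apply: (iffP andP) => [[/set0Pn[f fF] /subsetP sF]|[F1 FV FM]].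
  have FV2 x y z : x \in F -> y \in F -> z \in hmul (hstar x) y -> z \in F.
    by move=> xF yF zxy; apply/sF/(mem_cprod _ yF zxy)/imset_f.
  have F1 : hone \in F := FV2 _ _ _ fF fF (hstarV1 f).
  have FV x : x \in F -> hstar x \in F.
    by move=> xF; apply: (FV2 x hone) => //; rewrite hmulx1 set11.
  split=> // x y z xF yF; rewrite -[x]hstarK => zxy.
  exact: FV2 (FV _ xF) yF zxy.
split; first by apply/set0Pn; exists hone.
apply/subsetP => z /cprodP[_ [y [/imsetP[x xF ->] yF zxy]]].
exact: FM (FV _ xF) yF zxy.
Qed.

Lemma centerP x :
  reflect ((forall y, hmul x y = hmul y x) /\ hmul (hstar x) x = [set hone])
          (x \in center H).
Proof.
rewrite inE; apply: (iffP andP) => [[/forallP c /eqP i]|[c i]].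
  by split=> // y; apply/eqP.
by split; [apply/forallP => y; rewrite c | rewrite i].
Qed.

Lemma center_closed : hyperclosed (center H).
Proof.
have Z1 : hone \in center H.
  apply/centerP; split=> [y|]; first by rewrite hmul1x hmulx1.
  by rewrite hstar1 hmulx1.
have ZV x : x \in center H -> hstar x \in center H.
  move=> /centerP[c i]; apply/centerP; split=> [y|]; last first.
    by rewrite hstarK c.
  apply/setP => z; rewrite -[y]hstarK -[z]hstarK.
  by rewrite !mem_hmul_star c.
apply/closedP; split=> // x y z Zx Zy zxy.
have [cx ix] := centerP _ Zx; have [cy iy] := centerP _ Zy.
have Ez : [set x] :*: [set y] = [set z].
  apply/eqP; rewrite eqEsubset sub1set cprod11 zxy andbT.
  have [yxz _] := hmul_star zxy.
  have /subset_trans : hmul x y \subset [set x] :*: ([set hstar x] :*: [set z]).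
    by rewrite -[hmul x y]cprod11 cprodS // sub1set cprod11.
  by apply; rewrite cprodA cprod11 cx ix cprod11 hmul1x.
apply/centerP; split=> [t|].
  rewrite -!cprod11 -Ez -cprodA [[set y] :*: _]cprod11 cy -cprod11 !cprodA.
  by rewrite [[set x] :*: [set t]]cprod11 cx -cprod11.
have Ez' : [set hstar y] :*: [set hstar x] = [set hstar z].
  apply/setP => u; rewrite cprod11 -[u]hstarK mem_hmul_star -cprod11 Ez.
  by rewrite !in_set1 (can_eq hstarK).
rewrite -cprod11 -Ez -Ez' -cprodA [_ :*: ([set x] :*: _)]cprodA.
by rewrite [[set hstar x] :*: _]cprod11 ix cprod11 hmul1x cprod11 iy.
Qed.

End BasicTheory.

Section Quotient.
Variables (H : finHypergroupType) (F : closed_subset H).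
Implicit Types (a b h x y : H).

Definition double_coset h : {set H} := F :*: [set h] :*: F.

Definition double_cosets_of (S : {set H}) : {set {set H}} :=
  [set double_coset h | h in S].

Record quotient_hg := QuotientHg {
  quotient_hg_set :> {set H};
  _ : quotient_hg_set \in double_cosets_of [set: H]
}.

HB.instance Definition _ := [isSub for quotient_hg_set].
HB.instance Definition _ := [Finite of quotient_hg by <:].

Lemma double_coset_in h : double_coset h \in double_cosets_of [set: H].
Proof. exact: imset_f. Qed.

Definition coset_hg h : quotient_hg := QuotientHg (double_coset_in h).

Lemma coset_hg_surj (X : quotient_hg) : exists h, X == coset_hg h.
Proof.
by case: X => X /[dup] /imsetP[h _ ->] ?; exists h; apply/eqP/val_inj.
Qed.

Definition quotient_rep (X : quotient_hg) : H := xchoose (coset_hg_surj X).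

Lemma quotient_repK X : coset_hg (quotient_rep X) = X.
Proof. by exact/esym/eqP/(xchooseP (coset_hg_surj X)). Qed.

(* Independence of the chosen representatives is proved in quotient_mulE and
   quotient_starE below. *)
Definition quotient_mul (X Y : quotient_hg) : {set quotient_hg} :=
  [set coset_hg x |
     x in [set quotient_rep X] :*: F :*: [set quotient_rep Y]].

Definition quotient_one : quotient_hg := coset_hg hone.

Definition quotient_star (X : quotient_hg) : quotient_hg :=
  coset_hg (hstar (quotient_rep X)).

Let F1 : hone \in (F : {set H}).
Proof. by case/closedP: (closed_subsetP F). Qed.

Let FV x : x \in (F : {set H}) -> hstar x \in (F : {set H}).
Proof. by case/closedP: (closed_subsetP F) => _ + _; apply. Qed.

Let FF : F :*: F = F.
Proof.
case/closedP: (closed_subsetP F) => _ _ FM; apply/setP => x; apply/idP/idP.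
  by case/cprodP=> p [q [pF qF]]; apply: FM.
by move=> xF; apply: (mem_cprod xF F1); rewrite hmulx1 set11.
Qed.

Lemma double_cosetP x h :
  reflect (exists f g y, [/\ f \in (F : {set H}), g \in (F : {set H}),
                             y \in hmul f h & x \in hmul y g])
          (x \in double_coset h).
Proof.
apply: (iffP (cprodP _ _ _)).
  case=> y [g [/cprodP[f [_ [fF /set1P-> yfh]]] gF xyg]].
  by exists f, g, y.
case=> f [g [y [fF gF yfh xyg]]]; exists y, g; split=> //.
by apply: mem_cprod yfh => //; rewrite set11.
Qed.

Lemma mem_double_coset h : h \in double_coset h.
Proof.
by apply/double_cosetP; exists hone, hone, h; rewrite hmul1x hmulx1 set11.
Qed.

Lemma double_coset_sub x h :
  x \in double_coset h -> double_coset x \subset double_coset h.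
Proof.
rewrite -sub1set => sx.
have -> : double_coset h = F :*: double_coset h :*: F.
  by rewrite /double_coset !cprodA FF -[RHS]cprodA FF.
by rewrite !cprodS.
Qed.

Lemma double_coset_sym x h : x \in double_coset h -> h \in double_coset x.
Proof.
case/double_cosetP=> f [g [y [fF gF yfh xyg]]].
have [hy _] := hmul_star yfh; have [_ yx] := hmul_star xyg.
have [z zx hz] := hmulA_mem yx hy.
by apply/double_cosetP; exists (hstar f), (hstar g), z; split; rewrite ?FV.
Qed.

Lemma coset_hg_eqP x h :
  reflect (coset_hg x = coset_hg h) (x \in double_coset h).
Proof.
apply: (iffP idP) => [xh|[<-]]; last exact: mem_double_coset.
apply/val_inj/eqP; rewrite eqEsubset double_coset_sub //=.
exact/double_coset_sub/double_coset_sym.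
Qed.

Let mul_sub a a' b b' : coset_hg a = coset_hg a' -> coset_hg b = coset_hg b' ->
  [set coset_hg x | x in [set a] :*: F :*: [set b]] \subset
  [set coset_hg x | x in [set a'] :*: F :*: [set b']].
Proof.
move=> /coset_hg_eqP aa' /coset_hg_eqP bb'; apply/subsetP => X /imsetP[x xab ->].
have : x \in F :*: ([set a'] :*: F :*: [set b']) :*: F.
  have: [set a] :*: F :*: [set b]
          \subset double_coset a' :*: F :*: double_coset b'.
    by rewrite !cprodS ?sub1set.
  move/subsetP/(_ _ xab); rewrite /double_coset !cprodA.
  by rewrite -[_ :*: F :*: F]cprodA FF -[_ :*: F :*: F]cprodA FF.
case/cprodP=> y [g [/cprodP[f [w [fF wab yfw]]] gF xyg]].
apply/imsetP; exists w => //; apply/coset_hg_eqP/double_cosetP.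
by exists f, g, y.
Qed.

Lemma quotient_mulE a b :
  quotient_mul (coset_hg a) (coset_hg b) =
  [set coset_hg x | x in [set a] :*: F :*: [set b]].
Proof. by apply/eqP; rewrite eqEsubset !mul_sub // quotient_repK. Qed.

Lemma quotient_starE h : quotient_star (coset_hg h) = coset_hg (hstar h).
Proof.
have /coset_hg_eqP/double_cosetP[f [g [y [fF gF yfh xyg]]]] :=
  quotient_repK (coset_hg h).
apply/coset_hg_eqP; apply/double_cosetP.
move: xyg yfh; rewrite -mem_hmul_star => xyg; rewrite -mem_hmul_star => yfh.
have [z zg xz] := hmulA_mem yfh xyg.
by exists (hstar g), (hstar f), z; split; rewrite ?FV.
Qed.

Lemma quotient_one_set : quotient_one = F :> {set H}.
Proof.
apply/setP => x; apply/idP/idP => [/double_cosetP[f [g [y [fF gF]]]]|xF].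
  by rewrite hmulx1 => /set1P-> xfg; rewrite -FF; apply: mem_cprod xfg.
by apply/double_cosetP; exists x, hone, x; rewrite !hmulx1 set11.
Qed.

Let mul_setE (P Q : {set H}) :
  complex_product quotient_mul [set coset_hg x | x in P]
                  [set coset_hg x | x in Q] =
  [set coset_hg x | x in P :*: F :*: Q].
Proof.
apply/setP => X; apply/idP/imsetP.
  case/bigcupP=> _ /imsetP[p pP ->] /bigcupP[_ /imsetP[q qQ ->]].
  rewrite quotient_mulE => /imsetP[x xpq ->]; exists x => //.
  by move: x xpq; apply/subsetP; rewrite !cprodS ?sub1set.
case=> x /cprodP[y [q [/cprodP[p [f [pP fF ypf]]] qQ xyq]]] ->.
apply/bigcupP; exists (coset_hg p); first exact: imset_f.
apply/bigcupP; exists (coset_hg q); first exact: imset_f.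
rewrite quotient_mulE imset_f //; apply: mem_cprod (set11 q) xyq.
exact: mem_cprod (set11 p) fF ypf.
Qed.

Lemma quotient_mulA X Y Z :
  complex_product quotient_mul [set X] (quotient_mul Y Z) =
  complex_product quotient_mul (quotient_mul X Y) [set Z].
Proof.
rewrite -[X]quotient_repK -[Y]quotient_repK -[Z]quotient_repK !quotient_mulE.
by rewrite -!imset_set1 !mul_setE !cprodA.
Qed.

Lemma quotient_mulx1 X : quotient_mul X quotient_one = [set X].
Proof.
rewrite -[X]quotient_repK quotient_mulE; set a := quotient_rep X.
apply/setP => Y; apply/imsetP/set1P => [[x]|->].
  case/cprodP=> y [_ [/cprodP[_ [f [/set1P-> fF yaf]]] /set1P->]].
  rewrite hmulx1 => /set1P-> ->; apply/coset_hg_eqP/double_cosetP.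
  by exists hone, f, a; rewrite hmul1x set11.
exists a => //; apply: (mem_cprod (p := a) _ (set11 _)).
  by apply: mem_cprod (set11 _) F1 _; rewrite hmulx1 set11.
by rewrite hmulx1 set11.
Qed.

Lemma quotient_mul_star X Y Z : Z \in quotient_mul X Y ->
  Y \in quotient_mul (quotient_star X) Z /\
  X \in quotient_mul Z (quotient_star Y).
Proof.
rewrite -[X]quotient_repK -[Y]quotient_repK quotient_mulE.
set p := quotient_rep X; set q := quotient_rep Y.
case/imsetP=> x /cprodP[u [_ [/cprodP[_ [f [/set1P-> fF upf]]] /set1P-> xuq]]] ->.
rewrite !quotient_starE !quotient_mulE; split.
  have [v vfq xpv] := hmulA_mem' upf xuq.
  have [vpx _] := hmul_star xpv.
  apply/imsetP; exists v.
    apply: (mem_cprod _ (set11 x) vpx).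
    by apply: mem_cprod (set11 _) F1 _; rewrite hmulx1 set11.
  apply/esym/coset_hg_eqP/double_cosetP.
  by exists f, hone, v; rewrite hmulx1 set11.
have [_ uxq] := hmul_star xuq.
apply/imsetP; exists u.
  apply: (mem_cprod _ (set11 _) uxq).
  by apply: mem_cprod (set11 _) F1 _; rewrite hmulx1 set11.
apply/esym/coset_hg_eqP/double_cosetP.
by exists hone, f, p; rewrite hmul1x set11.
Qed.

HB.instance Definition _ := isFinHypergroup.Build quotient_hg
  quotient_mulA quotient_mulx1 quotient_mul_star.

End Quotient.

Section UpperCenter.
Variable H : finHypergroupType.
Implicit Types (F : closed_subset H).

Definition center_preim F : {set H} :=
  [set h | coset_hg F h \in center (quotient_hg F)].

Lemma mem_center_preim F h :
  (h \in center_preim F) = (coset_hg F h \in center (quotient_hg F)).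
Proof. by rewrite in_set. Qed.

Lemma center_preim_closed F : hyperclosed (center_preim F).
Proof.
have /closedP[Z1 ZV ZM] := center_closed (quotient_hg F).
have /closedP[F1 _ _] := closed_subsetP F.
apply/closedP; split=> [|x|x y z].
- by rewrite mem_center_preim; exact: Z1.
- rewrite !mem_center_preim => /ZV.
  by rewrite -[hstar _]/(quotient_star _) quotient_starE.
- rewrite !mem_center_preim => xZ yZ zxy; apply: (ZM _ _ _ xZ yZ).
  rewrite /hmul /= quotient_mulE imset_f //.
  apply: (mem_cprod _ (set11 y) zxy).
  by apply: mem_cprod (set11 x) F1 _; rewrite hmulx1 set11.
Qed.

Lemma trivial_closed : hyperclosed [set hone : H].
Proof.
apply/closedP; split=> [|x /set1P->|x y z /set1P-> /set1P->].
- exact: set11.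
- by rewrite hstar1 set11.
- by rewrite hmulx1.
Qed.

Fixpoint upper_center (i : nat) : closed_subset H :=
  if i is j.+1 then ClosedSubset (center_preim_closed (upper_center j))
  else ClosedSubset trivial_closed.

Lemma upper_center_quotient i :
  double_cosets_of (upper_center i) (upper_center i.+1) =
  [set quotient_hg_set X | X in center (quotient_hg (upper_center i))].
Proof.
apply/setP => X; apply/imsetP/imsetP => -[].
  move=> h; rewrite mem_center_preim => hZ ->.
  by exists (coset_hg (upper_center i) h).
move=> Y YZ ->; exists (quotient_rep Y).
  by rewrite mem_center_preim quotient_repK.
by rewrite -[in LHS](quotient_repK Y).
Qed.

Definition weakly_nilpotent : Prop :=
  exists n : nat, upper_center n = [set: H] :> {set H}.

End UpperCenter.

(* Main.v *)
Require Import Defs.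
From mathcomp Require Import all_boot.

(** Write [Z_i] for the upper central series.  The chain joining [F] to the
whole hypergroup is [F Z_0 = F], [F Z_1], and so on up to [F Z_n = H], exactly
as for nilpotent groups.

Two facts make each [F Z_i] strongly normal in [F Z_(i+1)].  First, every [Z_i]
commutes as a set with every element ([commutes_center_preim], by induction
along the series), so [F Z_i] is closed ([cprod_closed]).  Second, an element
[z] of [Z_(i+1)] is central modulo [N = Z_i] and satisfies [z^* z = 1] modulo
[N]: lifted to [H] this reads [z h N = h z N] for all [h]
([center_preim_comm]) and [z^* z] lies in [N] ([center_preim_star]).
Hence [z^* F N z = z^* z F N], which lies in [F N].  A general element of
[F Z_(i+1)] lies in some [f z], and conjugation by [f] sends [F N] into itself
because [F N] is closed and contains [f] ([strongly_normal_cprod]). *)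

Set Implicit Arguments.
Unset Strict Implicit.
Unset Printing Implicit Defensive.

Local Open Scope hypergroup_scope.

Section ComplexProducts.
Variable H : finHypergroupType.
Implicit Types (F N P Q R S : {set H}) (h x : H).

Definition commutes_with_all N : Prop :=
  forall h, N :*: [set h] = [set h] :*: N.

Lemma cprodx1 P : P :*: [set hone] = P.
Proof.
apply/setP => x; apply/idP/idP.
  by case/cprodP=> p [_ [pP /set1P->]]; rewrite hmulx1 => /set1P->.
by move=> xP; apply: (mem_cprod xP (set11 _)); rewrite hmulx1 set11.
Qed.

Lemma cprod1x P : [set hone] :*: P = P.
Proof.
apply/setP => x; apply/idP/idP.
  by case/cprodP=> _ [p [/set1P-> pP]]; rewrite hmul1x => /set1P->.
by move=> xP; apply: (mem_cprod (set11 _) xP); rewrite hmul1x set11.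
Qed.

(** Complex products are unions over elements, so inclusions may be tested on
singletons in the middle factor; this lifts commutation from elements to
sets. *)
Lemma cprod_sub_mid Q P R S :
  (forall h, h \in P -> Q :*: [set h] :*: R \subset S) ->
  Q :*: P :*: R \subset S.
Proof.
move=> sS; apply/subsetP => x /cprodP[y [r [/cprodP[q [p [qQ pP yqp]]] rR xyr]]].
apply: (subsetP (sS p pP)); apply: mem_cprod rR xyr.
exact: mem_cprod qQ (set11 p) yqp.
Qed.

Lemma cprod_comm_mid Q R P :
  (forall h, Q :*: [set h] :*: R = [set h] :*: Q :*: R) ->
  Q :*: P :*: R = P :*: Q :*: R.
Proof.
move=> cQ; apply/eqP; rewrite eqEsubset; apply/andP; split.
  by apply: cprod_sub_mid => h hP; rewrite cQ !cprodS ?sub1set.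
have <-: [set hone] :*: P :*: (Q :*: R) = P :*: Q :*: R by rewrite cprod1x cprodA.
apply: cprod_sub_mid => h hP.
by rewrite cprod1x cprodA -cQ !cprodS ?sub1set.
Qed.

Lemma commutes_with_set N P : commutes_with_all N -> N :*: P = P :*: N.
Proof.
move=> cN; rewrite -[LHS]cprodx1 -[RHS]cprodx1.
by apply: cprod_comm_mid => h; rewrite cN.
Qed.

Lemma closed_idem F : hyperclosed F -> F :*: F = F.
Proof.
case/closedP=> F1 _ FM; apply/setP => x; apply/idP/idP.
  by case/cprodP=> p [q [pF qF]]; apply: FM.
by move=> xF; apply: (mem_cprod xF F1); rewrite hmulx1 set11.
Qed.

Lemma cprod_subl P N : hone \in N -> P \subset P :*: N.
Proof. by move=> N1; rewrite -{1}[P]cprodx1 cprodS ?sub1set. Qed.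

(** As for subgroups, [F N] is closed because [F N = N F]. *)
Lemma cprod_closed F N :
  hyperclosed F -> hyperclosed N -> commutes_with_all N ->
  hyperclosed (F :*: N).
Proof.
move=> cF cN comN.
have [F1 FV _] := closedP _ cF; have [N1 NV _] := closedP _ cN.
apply/closedP; split=> [|x|x y z xFN yFN zxy].
- exact: (subsetP (cprod_subl F N1)).
- case/cprodP=> f [n [fF nN xfn]]; rewrite -(commutes_with_set F comN).
  by apply: (mem_cprod (NV _ nN) (FV _ fF)); rewrite mem_hmul_star.
- suff <-: (F :*: N) :*: (F :*: N) = F :*: N by apply: mem_cprod zxy.
  by rewrite cprodA -[F :*: N :*: F]cprodA (commutes_with_set F comN) cprodA
    closed_idem // -cprodA closed_idem.
Qed.

End ComplexProducts.

Section CenterPreimage.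
Variables (H : finHypergroupType) (N : closed_subset H).
Hypothesis comN : commutes_with_all (N : {set H}).
Let cN : hyperclosed N := closed_subsetP N.
Let Z := center_preim N.
Implicit Types (F P : {set H}) (h z : H).

Let N1 : hone \in (N : {set H}). Proof. by case/closedP: cN. Qed.

Lemma center_preim_star z : z \in Z -> hmul (hstar z) z \subset N.
Proof.
rewrite mem_center_preim => /centerP[_].
rewrite -[hstar _]/(quotient_star _) quotient_starE.
rewrite -[hmul _ _]/(quotient_mul _ _) quotient_mulE => zz.
apply/subsetP => x xzz; rewrite -(quotient_one_set N).
suff /set1P <- : coset_hg N x \in [set quotient_one N].
  exact: mem_double_coset.
rewrite -[[set quotient_one N]]zz imset_f // (mem_cprod _ (set11 z) xzz) //.
exact: (subsetP (cprod_subl _ N1)) (set11 _).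
Qed.

(** Equality of the products of two cosets only compares double cosets; as [N]
commutes with everything, the surrounding copies of [N] can be moved to the
right and merged. *)
Let quotient_mul_sub a b c d :
  hmul (coset_hg N a) (coset_hg N b) = hmul (coset_hg N c) (coset_hg N d) ->
  [set a] :*: [set b] :*: N \subset [set c] :*: [set d] :*: N.
Proof.
rewrite -[LHS]/(quotient_mul _ _) -[RHS]/(quotient_mul _ _) !quotient_mulE => E.
suff sab : [set a] :*: [set b] \subset [set c] :*: [set d] :*: N.
  by apply: subset_trans (cprodS sab (subxx _)) _; rewrite -cprodA closed_idem.
apply/subsetP => x xab.
have : coset_hg N x \in [set coset_hg N y | y in [set a] :*: N :*: [set b]].
  by rewrite imset_f // (subsetP _ _ xab) // cprodS // cprod_subl.
rewrite E => /imsetP[y ycd /coset_hg_eqP xy].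
have: x \in N :*: ([set c] :*: N :*: [set d]) :*: N.
  by apply: (subsetP _ _ xy); rewrite !cprodS ?sub1set.
rewrite -[[set c] :*: _ :*: _]cprodA (comN d) [[set c] :*: _]cprodA.
by rewrite (commutes_with_set _ comN) -!cprodA !(closed_idem cN).
Qed.

Lemma center_preim_comm z h :
  z \in Z -> [set z] :*: [set h] :*: N = [set h] :*: [set z] :*: N.
Proof.
rewrite mem_center_preim => /centerP[com _].
by apply/eqP; rewrite eqEsubset !quotient_mul_sub ?com.
Qed.

Lemma subset_center_preim : N \subset Z.
Proof.
apply/subsetP => n nN; rewrite mem_center_preim.
have -> : coset_hg N n = hone.
  apply: (coset_hg_eqP _ _ hone _).
  by rewrite -[double_coset _ _]/(quotient_one N : {set H}) quotient_one_set.
by case/closedP: (center_closed (quotient_hg N)).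
Qed.

Let ZN : Z :*: N \subset Z.
Proof.
have ZZ : Z :*: Z = Z := closed_idem (center_preim_closed N).
by rewrite -{2}ZZ cprodS // subset_center_preim.
Qed.

(** Commutation modulo [N] becomes genuine commutation with the whole preimage,
since the error factor [N] is absorbed by [Z]. *)
Lemma commutes_center_preim : commutes_with_all Z.
Proof.
move=> h; apply/eqP; rewrite eqEsubset; apply/andP; split.
  rewrite -[Z]cprod1x; apply: cprod_sub_mid => z zZ.
  rewrite !cprod1x; apply: subset_trans (cprod_subl _ N1) _.
  rewrite center_preim_comm // -cprodA cprodS //.
  by apply: subset_trans ZN; rewrite cprodS ?sub1set.
rewrite -[[set h] :*: Z]cprodx1; apply: cprod_sub_mid => z zZ.
rewrite cprodx1; apply: subset_trans (cprod_subl _ N1) _.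
rewrite -center_preim_comm // -cprodA -comN cprodA cprodS //.
by apply: subset_trans ZN; rewrite cprodS ?sub1set.
Qed.

(** For [h] in [f z], conjugation by [h] is conjugation by [f], under which the
closed set [F N] is stable, followed by conjugation by [z], which is trivial
modulo [N]. *)
Lemma strongly_normal_cprod F :
  hyperclosed F -> strongly_normal (F :*: N) (F :*: Z).
Proof.
move=> cF; split; first exact: cprod_closed.
  by rewrite cprodS // subset_center_preim.
move=> h /cprodP[f [z [fF zZ hfz]]].
have [_ FV _] := closedP _ cF.
have FfN : [set hstar f] :*: (F :*: N) :*: [set f] \subset F :*: N.
  have sFN u : u \in F -> [set u] \subset F :*: N.
    by move=> uF; rewrite sub1set (subsetP (cprod_subl F N1)).
  have FNK := closed_idem (cprod_closed cF cN comN).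
  by rewrite -{2}FNK -{2}FNK !cprodS ?sFN ?FV.
have sh : [set h] \subset [set f] :*: [set z] by rewrite sub1set cprod11.
have shV : [set hstar h] \subset [set hstar z] :*: [set hstar f].
  by rewrite sub1set cprod11 mem_hmul_star.
apply: subset_trans (cprodS (cprodS shV (subxx _)) sh) _.
have -> : [set hstar z] :*: [set hstar f] :*: (F :*: N) :*: ([set f] :*: [set z])
        = [set hstar z] :*: ([set hstar f] :*: (F :*: N) :*: [set f]) :*: [set z].
  by rewrite !cprodA.
apply: subset_trans (cprodS (cprodS (subxx _) FfN) (subxx _)) _.
(* Move z leftwards past N and F until it meets its star. *)
rewrite -!cprodA comN [F :*: _]cprodA.
rewrite -(cprod_comm_mid _ (fun h => center_preim_comm h zZ)) -!cprodA.
rewrite cprodA cprod11.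
apply: subset_trans (cprodS (center_preim_star zZ) (subxx _)) _.
by rewrite (commutes_with_set _ comN) -cprodA closed_idem.
Qed.

End CenterPreimage.

Lemma commutes_upper_center (H : finHypergroupType) i :
  commutes_with_all (upper_center H i : {set H}).
Proof.
elim: i => [|i IHi] /=; last exact: commutes_center_preim.
by move=> h; rewrite cprod1x cprodx1.
Qed.

Theorem theorem1p9 (H : finHypergroupType) (hH : weakly_nilpotent H)
  (F : {set H}) (hF : hyperclosed F) : strongly_subnormal F.
Proof.
have [n Zn] := hH; have [F1 _ _] := closedP _ hF.
(* The extra step past n keeps the chain of positive length when n = 0. *)
exists n.+1, (fun i => F :*: upper_center H i); split=> //.
- exact: cprodx1.
- have ZSn : upper_center H n.+1 = [set: H] :> {set H}.
    by apply/eqP; rewrite -subTset -Zn subset_center_preim.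
  apply/eqP; rewrite ZSn -subTset -{1}[[set: H]]cprod1x.
  by rewrite cprodS ?sub1set.
- move=> i _; apply: cprod_closed => //; first exact: closed_subsetP.
  exact: commutes_upper_center.
- case=> // i _ /=; apply: strongly_normal_cprod => //.
  exact: commutes_upper_center.
Qed.
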